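(* Let $\mathbb{K}$ be a field of characteristic zero, $\mathbb{F}$ an algebraic closure of $\mathbb{K}$, $\alpha\in\mathbb{F}$ algebraic of degree $n$ over $\mathbb{K}$ with conjugates $\alpha_0=\alpha,\alpha_1,\dots,\alpha_{n-1}$, and $\sigma_j$ ($0\le j\le n-1$) $\mathbb{K}$-automorphisms of $\mathbb{F}$ with $\sigma_j(\alpha)=\alpha_j$, $\sigma_0=\mathrm{Id}$. Let $\psi=(\psi_1,\dots,\psi_m)\in\mathbb{K}(\alpha)(t)^m$ be a proper parametrization of a rational curve $\mathcal{C}\subseteq\mathbb{F}^m$, with $\psi_i(t)=n_i(t)/d_i(t)$ and $\psi_i^{\sigma_j}(t)=n_i^{\sigma_j}(t)/d_i^{\sigma_j}(t)$. For $1\le j\le n-1$ let $$B_{\sigma_j}=\{n_i(t)\, d_i^{\sigma_j}(s)-n_i^{\sigma_j}(s)\, d_i(t)\ :\ 1\le i\le m\}\subseteq\mathbb{F}[t,s].$$ (1) If $\mathcal{C}$ is defined over $\mathbb{K}$, then for each $j$ the numerator of $s-u_j(t)$ is a polynomial of degree $1$ in $t$ and of degree $1$ in $s$, and it is (up to a nonzero constant) the greatest common divisor of the polynomials in $B_{\sigma_j}$. (2) If $\mathcal{C}$ is not defined over $\mathbb{K}$, then there is an index $1\le j\le n-1$ such that $\gcd(B_{\sigma_j})=1$.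
   Context: A parametrization is proper if it is birational onto its image. A curve is defined over $\mathbb{K}$ if it is the zero set of polynomials with coefficients in $\mathbb{K}$. For a rational function $f$ with coefficients in $\mathbb{F}$, $f^{\sigma}$ is obtained by applying $\sigma$ to its coefficients. Definition of $u_j$ (when $\mathcal{C}$ is defined over $\mathbb{K}$): substitute $t=\sum_{i=0}^{n-1}\alpha^it_i$ and write $\psi_l(\sum_i\alpha^it_i)=\sum_{i=0}^{n-1}\alpha^iF_{il}/D$ with $F_{il},D\in\mathbb{K}[t_0,\dots,t_{n-1}]$; the Zariski closure of $\{F_{il}=0,\ 1\le i\le n-1,\ 1\le l\le m\}\setminus\{D=0\}$ in $\mathbb{F}^n$ has a unique one-dimensional component $\mathcal{U}$ (the hypercircle associated to $\psi$), which has a proper parametrization $\phi=(\phi_0,\dots,\phi_{n-1})$ (the standard parametrization) with $\sum_{i=0}^{n-1}\alpha^i\phi_i(t)=t$. Then $u_j(t)=\sum_{i=0}^{n-1}\alpha_j^i\phi_i(t)=(\phi^{\sigma_j})^{-1}\circ\phi$, a fractional linear transformation of $t$.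
   Formalization: The fractions n_i/d_i are assumed reduced (n_i and d_i coprime, d_i nonzero); without this the gcd claims fail, e.g. for n = t^2, d = t, where B_σ consists of ts(t-s). *)

(* Defs.v *)
From HB Require Import structures.
From mathcomp Require Import all_boot all_order all_algebra.
From mathcomp Require Import mpoly.
Set Implicit Arguments. Unset Strict Implicit. Unset Printing Implicit Defensive.
Import Order.TTheory GRing.Theory Num.Theory.
Local Open Scope ring_scope.

Definition alg_degree (F : fieldType) (K : {pred F}) (alpha : F) (n : nat) : Prop :=
  (exists p : {poly F}, [/\ p \is a polyOver K, p \is monic, size p = n.+1 & root p alpha])
  /\ (forall q : {poly F}, q \is a polyOver K -> q != 0 -> root q alpha -> (n < size q)%N).

(* membership in K(alpha) = K[alpha] (alpha algebraic) *)
Definition in_Kalpha (F : fieldType) (K : {pred F}) (alpha : F) (x : F) : Prop :=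
  exists p : {poly F}, p \is a polyOver K /\ x = p.[alpha].

Definition coefs_in (F : fieldType) (P : F -> Prop) (p : {poly F}) : Prop :=
  forall i, P p`_i.

Definition zsubset (F : fieldType) (k : nat) (X Y : ('I_k -> F) -> Prop) : Prop :=
  forall x, X x -> Y x.
Definition zpsubset (F : fieldType) (k : nat) (X Y : ('I_k -> F) -> Prop) : Prop :=
  zsubset X Y /\ exists x, Y x /\ ~ X x.

Definition zset (F : fieldType) (k : nat) (S : {mpoly F[k]} -> Prop) : ('I_k -> F) -> Prop :=
  fun x => forall p, S p -> p.@[x] = 0.

Definition zclosed (F : fieldType) (k : nat) (X : ('I_k -> F) -> Prop) : Prop :=
  exists S : {mpoly F[k]} -> Prop, forall x, X x <-> zset S x.

Definition zclosure (F : fieldType) (k : nat) (A : ('I_k -> F) -> Prop) : ('I_k -> F) -> Prop :=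
  fun x => forall p : {mpoly F[k]}, (forall a, A a -> p.@[a] = 0) -> p.@[x] = 0.

Definition defined_over (F : fieldType) (K : {pred F}) (k : nat) (X : ('I_k -> F) -> Prop) : Prop :=
  exists S : {mpoly F[k]} -> Prop,
    (forall p, S p -> p \is a mpolyOver k K) /\ forall x, X x <-> zset S x.

Definition zirred (F : fieldType) (k : nat) (X : ('I_k -> F) -> Prop) : Prop :=
  [/\ zclosed X, exists x, X x &
      forall Y Z, zclosed Y -> zclosed Z -> (forall x, X x <-> Y x \/ Z x) ->
        zsubset X Y \/ zsubset X Z].

Definition zcomponent (F : fieldType) (k : nat) (X U : ('I_k -> F) -> Prop) : Prop :=
  [/\ zirred U, zsubset U X &
      forall V, zirred V -> zsubset U V -> zsubset V X -> zsubset V U].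

Definition zdim1 (F : fieldType) (k : nat) (U : ('I_k -> F) -> Prop) : Prop :=
  (exists Z, zirred Z /\ zpsubset Z U) /\
  ~ (exists Z0 Z1, [/\ zirred Z0, zirred Z1, zpsubset Z0 Z1 & zpsubset Z1 U]).

Definition pdom (F : fieldType) (k : nat) (de : 'I_k -> {poly F}) (t : F) : Prop :=
  forall i, (de i).[t] != 0.

Definition ppt (F : fieldType) (k : nat) (nu de : 'I_k -> {poly F}) (t : F) : 'I_k -> F :=
  fun i => (nu i).[t] / (de i).[t].

Definition pimage (F : fieldType) (k : nat) (nu de : 'I_k -> {poly F}) : ('I_k -> F) -> Prop :=
  fun x => exists t, pdom de t /\ x = ppt nu de t.

Definition pcurve (F : fieldType) (k : nat) (nu de : 'I_k -> {poly F}) : ('I_k -> F) -> Prop :=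
  zclosure (pimage nu de).

(* proper = birational onto its image: there is a rational function P/Q on the
   curve (Q not vanishing identically on it) inverting the parametrization *)
Definition proper_param (F : fieldType) (k : nat) (nu de : 'I_k -> {poly F}) : Prop :=
  exists P Q : {mpoly F[k]},
    (exists t, pdom de t /\ Q.@[ppt nu de t] != 0) /\
    forall t, pdom de t -> P.@[ppt nu de t] = t * Q.@[ppt nu de t].

Definition alpha_sub (F : fieldType) (n : nat) (alpha : F) : {mpoly F[n]} :=
  \sum_(i < n) alpha ^+ i *: 'X_i.

Definition psubst (F : fieldType) (n : nat) (p : {poly F}) (x : {mpoly F[n]}) : {mpoly F[n]} :=
  (map_poly (@mpolyC n F) p).[x].

(* psi_l(sum alpha^i t_i) = sum_i alpha^i F_il / D with F_il, D in K[t_0..t_{n-1}] *)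
Definition hyper_decomp (F : fieldType) (K : {pred F}) (n m : nat) (alpha : F)
    (nn dd : 'I_m -> {poly F}) (Fil : 'I_n -> 'I_m -> {mpoly F[n]}) (D : {mpoly F[n]}) : Prop :=
  [/\ D != 0, D \is a mpolyOver n K, (forall i l, Fil i l \is a mpolyOver n K) &
      forall l, psubst (nn l) (alpha_sub n alpha) * D =
                psubst (dd l) (alpha_sub n alpha) * \sum_(i < n) alpha ^+ i *: Fil i l].

Definition hyper_W (F : fieldType) (n m : nat) (Fil : 'I_n -> 'I_m -> {mpoly F[n]})
    (D : {mpoly F[n]}) : ('I_n -> F) -> Prop :=
  fun x => D.@[x] != 0 /\ forall (i : 'I_n) (l : 'I_m), (0 < i)%N -> (Fil i l).@[x] = 0.

Definition hypercircle (F : fieldType) (n m : nat) (Fil : 'I_n -> 'I_m -> {mpoly F[n]})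
    (D : {mpoly F[n]}) (U : ('I_n -> F) -> Prop) : Prop :=
  zcomponent (zclosure (hyper_W Fil D)) U /\ zdim1 U.

Definition standard_param (F : fieldType) (n : nat) (alpha : F) (U : ('I_n -> F) -> Prop)
    (p q : 'I_n -> {poly F}) : Prop :=
  [/\ forall x, U x <-> pcurve p q x, proper_param p q &
      forall t, pdom q t -> \sum_(i < n) alpha ^+ i * ppt p q t i = t].

Definition u_fun (F : fieldType) (n : nat) (alphaj : F) (p q : 'I_n -> {poly F}) (t : F) : F :=
  \sum_(i < n) alphaj ^+ i * ppt p q t i.

(* ---------- bivariate polynomials: {poly {poly F}}, outer variable s, inner t ---------- *)

Definition Bpoly (F : fieldType) (m : nat) (s : {rmorphism F -> F}) (nn dd : 'I_m -> {poly F})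
    (i : 'I_m) : {poly {poly F}} :=
  (nn i)%:P * (map_poly s (dd i))^:P - (map_poly s (nn i))^:P * (dd i)%:P.

Definition Bset (F : fieldType) (m : nat) (s : {rmorphism F -> F}) (nn dd : 'I_m -> {poly F})
    : {poly {poly F}} -> Prop :=
  fun P => exists i, P = Bpoly s nn dd i.

Definition rdvd (R : comNzRingType) (a b : R) : Prop := exists c, b = c * a.

Definition is_gcd (R : comNzRingType) (S : R -> Prop) (g : R) : Prop :=
  (forall b, S b -> rdvd g b) /\ (forall c, (forall b, S b -> rdvd c b) -> rdvd c g).

(* Main.v *)
(* Write B_l = n_l(t) d'_l(s) - n'_l(s) d_l(t) for two proper reduced parametrizations
   psi = n/d and psi' = n'/d'.  A common divisor c of the B_l has no factor in t or s
   alone, since psi and psi' are not constant.  Modulo c we have psi(t) = psi'(s), and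
   the rational inverse P/Q of psi' turns this into s Q(psi(t)) = P(psi(t)), a relation
   of degree one in s; hence a common divisor b(t) s - a(t) is the gcd, and exchanging
   s and t bounds its degree in t.
   (1) On the hypercircle n_l(t) d'_l(u_j(t)) = n'_l(u_j(t)) d_l(t), where ' is
   conjugation by sigma_j, so the numerator of s - u_j(t) divides every B_l.
   (2) If every B_{sigma_j} has a nonconstant common divisor, then for almost every t
   there is s with psi(t) = psi^{sigma_j}(s), so the conjugates of an equation of C
   over K(alpha) vanish on C again.  Inverting a Vandermonde system, so do its
   components over K in the basis 1, alpha, ..., alpha^(n-1).  As C is cut out by
   equations over K(alpha), it is then defined over K. *)
Require Import Defs.
From HB Require Import structures.
From mathcomp Require Import all_boot all_order all_algebra.
From mathcomp Require Import mpoly.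
From mathcomp Require Import ring.
From Stdlib Require Import Classical.
Import GRing.Theory.
Local Open Scope ring_scope.

(** * Divisibility of bivariate polynomials *)

Definition rmodeq {R : comNzRingType} (c x y : R) : Prop := rdvd c (x - y).

Lemma rdvd0 {R : comNzRingType} (a : R) : rdvd a 0.
Proof. by exists 0; rewrite mul0r. Qed.

Lemma rdvd_mull {R : comNzRingType} (a b c : R) : rdvd a b -> rdvd a (c * b).
Proof. by case=> x ->; exists (c * x); rewrite mulrA. Qed.

Lemma rdvdD {R : comNzRingType} (a b c : R) : rdvd a b -> rdvd a c -> rdvd a (b + c).
Proof. by case=> x -> [y ->]; exists (x + y); rewrite mulrDl. Qed.

Lemma rdvdN {R : comNzRingType} (a b : R) : rdvd a b -> rdvd a (- b).
Proof. by case=> x ->; exists (- x); rewrite mulNr. Qed.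

Lemma rmodeq_refl {R : comNzRingType} (c x : R) : rmodeq c x x.
Proof. by rewrite /rmodeq subrr; apply: rdvd0. Qed.

Lemma rmodeqD {R : comNzRingType} (c x y z t : R) :
  rmodeq c x y -> rmodeq c z t -> rmodeq c (x + z) (y + t).
Proof. by move=> h1 h2; rewrite /rmodeq opprD addrACA; apply: rdvdD. Qed.

Lemma rmodeqM {R : comNzRingType} (c x y z t : R) :
  rmodeq c x y -> rmodeq c z t -> rmodeq c (x * z) (y * t).
Proof.
case=> u hu [v hv]; exists (u * z + y * v).
by rewrite mulrDl -mulrA (mulrC z) mulrA -hu -mulrA -hv; ring.
Qed.

Lemma rmodeqX {R : comNzRingType} (c x y : R) k :
  rmodeq c x y -> rmodeq c (x ^+ k) (y ^+ k).
Proof.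
move=> h; elim: k => [|k IH]; first exact: rmodeq_refl.
by rewrite !exprS; apply: rmodeqM.
Qed.

Lemma rdvd_size {R : idomainType} {c g : {poly R}} :
  rdvd c g -> g != 0 -> (size c <= size g)%N.
Proof.
case=> x -> nz; move: (nz); rewrite mulf_eq0 negb_or => /andP[x0 c0].
by rewrite size_mul // -subn1 -addnBAC ?size_poly_gt0 // leq_addl.
Qed.

Lemma swapXY_rdvd {F : comNzRingType} (c g : {poly {poly F}}) :
  rdvd (swapXY c) (swapXY g) <-> rdvd c g.
Proof.
have sub a b : rdvd a b -> rdvd (swapXY a) (swapXY b).
  by case=> x ->; exists (swapXY x); rewrite rmorphM.
by split=> [/sub|]; [rewrite (swapXYK c) (swapXYK g) | apply: sub].
Qed.

(* The outer variable of [{poly {poly F}}] is s, the inner one t; [evt r] is the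
   substitution t := r. *)
Definition evt {F : fieldType} (r : F) (c : {poly {poly F}}) : {poly F} :=
  (swapXY c).[r%:P].

Lemma evtM {F : fieldType} (r : F) c d : evt r (c * d) = evt r c * evt r d.
Proof. by rewrite /evt rmorphM hornerM. Qed.

Lemma evtD {F : fieldType} (r : F) c d : evt r (c + d) = evt r c + evt r d.
Proof. by rewrite /evt rmorphD hornerD. Qed.

Lemma evtN {F : fieldType} (r : F) c : evt r (- c) = - evt r c.
Proof. by rewrite /evt rmorphN hornerN. Qed.

Lemma evtX {F : fieldType} (r : F) : evt r 'X = 'X.
Proof. by rewrite /evt swapXY_X hornerC. Qed.

Lemma evtC {F : fieldType} (r : F) (e : {poly F}) : evt r e%:P = e.[r]%:P.
Proof. by rewrite /evt swapXY_polyC horner_map. Qed.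

Lemma evtP {F : fieldType} (r : F) (e : {poly F}) : evt r e^:P = e.
Proof. by rewrite /evt swapXY_map_polyC hornerC. Qed.

Lemma hornerP {F : fieldType} (r : F) (e : {poly F}) : (e^:P).[r%:P] = e.[r]%:P.
Proof. by rewrite horner_map. Qed.

Lemma evt_coef {F : fieldType} (r : F) c i : (evt r c)`_i = (c`_i).[r].
Proof. by rewrite /evt horner_swapXY coef_map. Qed.

Lemma evt_eq0_rdvd {F : fieldType} (r : F) c :
  evt r c = 0 -> rdvd ('X - r%:P)%:P c.
Proof.
rewrite /evt => /eqP /factor_theorem [q hq].
exists (swapXY q); rewrite -[LHS]swapXYK hq rmorphM rmorphB /= swapXY_X.
by rewrite swapXY_polyC map_polyC /= polyCB.
Qed.

(** Over an algebraically closed field this says that [c] is nonzero without nonconstant factors in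
    t alone: it is primitive as a polynomial in s over F[t]. *)
Definition tprimitive {F : fieldType} (c : {poly {poly F}}) : Prop :=
  forall r, evt r c != 0.

(** Gauss's lemma, by induction on the degree of [e]. A factor t - r of [e] divides the product of
    [c] with its cofactor; since [c] does not vanish at t = r, it divides the cofactor and
    cancels. *)
Lemma tprimitive_gauss {F : closedFieldType} (c g : {poly {poly F}}) (e : {poly F}) :
  e != 0 -> tprimitive c -> rdvd c (e%:P * g) -> rdvd c g.
Proof.
move=> + pc; elim: {e}(size e) {-2}e (leqnn (size e)) => [|k IH] e.
  by rewrite leqn0 size_poly_eq0 => /eqP -> /eqP.
move=> se e0 [h hh].
have [/eqP/size_poly1P [x x0 ex]|/closed_rootP [r /factor_theorem [q eq]]] := eqVneq (size e) 1%N.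
  exists ((x^-1)%:P%:P * h); rewrite -mulrA -hh ex mulrA -!polyCM.
  by rewrite mulVf // !polyC1 mul1r.
have q0 : q != 0 by apply: contra_neq e0 => q0; rewrite eq q0 mul0r.
have : evt r (e%:P * g) = 0 by rewrite evtM evtC eq !hornerE subrr mulr0 polyC0 mul0r.
rewrite hh evtM => /eqP; rewrite mulf_eq0 (negbTE (pc r)) orbF => /eqP /evt_eq0_rdvd [h' eh].
apply: (IH q) => //.
  by move: se; rewrite eq size_Mmonic ?monicXsubC // size_XsubC addn2.
exists h'; apply: (@mulfI _ ('X - r%:P)%:P); first by rewrite polyC_eq0 polyXsubC_eq0.
by rewrite mulrA (mulrA _ h') (mulrC _ h') -eh -hh eq polyCM (mulrC q%:P).
Qed.

(** * Homogenised substitution of a rational parametrization *)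

Lemma pdomE {F : fieldType} {m} (d : 'I_m -> {poly F}) t :
  pdom d t <-> (\prod_i d i).[t] != 0.
Proof.
rewrite horner_prod; split=> [h|/prodf_neq0 h i]; last exact: h.
by apply/prodf_neq0 => i _; apply: h.
Qed.

Lemma proddom_neq0 {F : fieldType} {m} (d : 'I_m -> {poly F}) :
  (forall i, d i != 0) -> \prod_i d i != 0.
Proof. by move=> h; apply/prodf_neq0. Qed.

Lemma poly_cofinite0 {F : closedFieldType} (p q : {poly F}) :
  q != 0 -> (forall t, q.[t] != 0 -> p.[t] = 0) -> p = 0.
Proof.
move=> q0 h; apply/eqP; apply: contraT => p0.
have /closed_nonrootP [x] : p * q != 0 by rewrite mulf_neq0.
rewrite /root hornerM mulf_eq0 negb_or => /andP[+ qx].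
by rewrite h // eqxx.
Qed.

(** Numerator of f(n/d) over the common denominator \prod_i d_i^k. The truncated subtraction is
    harmless as long as [k] bounds every exponent in [f], which [msize f <= k] ensures. *)
Definition hsubst {F : fieldType} {m} (k : nat) (n d : 'I_m -> {poly F})
    (f : {mpoly F[m]}) : {poly F} :=
  \sum_(mm <- msupp f) f@_mm *: \prod_i (n i ^+ mm i * d i ^+ (k - mm i)).

Lemma msupp_exp_le {F : fieldType} {m} {f : {mpoly F[m]}} {k mm} (i : 'I_m) :
  (msize f <= k)%N -> mm \in msupp f -> (mm i <= k)%N.
Proof.
move=> fk /msize_mdeg_lt h; apply: leq_trans fk; apply: leq_trans (ltnW h).
by rewrite mdegE (bigD1 i) //= leq_addr.
Qed.

Lemma hsubstE {F : fieldType} {m} k (n d : 'I_m -> {poly F}) f t :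
  (msize f <= k)%N -> pdom d t ->
  (hsubst k n d f).[t] = f.@[ppt n d t] * (\prod_i d i ^+ k).[t].
Proof.
move=> fk dt; rewrite mevalE mulr_suml horner_sum; apply: eq_big_seq => mm fm.
rewrite hornerZ -mulrA !horner_prod -big_split /=; congr (_ * _).
apply: eq_bigr => i _; rewrite hornerM !horner_exp /ppt expr_div_n.
rewrite -{2}(subnK (msupp_exp_le i fk fm)) exprD.
have := dt i; set x := (d i).[t] => x0.
by field; rewrite expf_neq0.
Qed.

(** * Common divisors of the polynomials B_l *)

(** The two parametrizations are unrelated here, so that exchanging s and t merely swaps their
    roles. *)
Definition Bgen {F : fieldType} {m} (n1 d1 n2 d2 : 'I_m -> {poly F}) (i : 'I_m)
    : {poly {poly F}} :=
  (n1 i)%:P * (d2 i)^:P - (n2 i)^:P * (d1 i)%:P.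

Definition Bdiv {F : fieldType} {m} (n1 d1 n2 d2 : 'I_m -> {poly F})
    (c : {poly {poly F}}) : Prop :=
  forall i, rdvd c (Bgen n1 d1 n2 d2 i).

Lemma swapXY_Bgen {F : fieldType} {m} (n1 d1 n2 d2 : 'I_m -> {poly F}) i :
  swapXY (Bgen n1 d1 n2 d2 i) = - Bgen n2 d2 n1 d1 i.
Proof.
rewrite /Bgen rmorphB !rmorphM /= !swapXY_polyC !swapXY_map_polyC opprB.
by rewrite mulrC [X in _ - X]mulrC [in RHS]mulrC; ring.
Qed.

Lemma swapXY_Bdiv {F : fieldType} {m} (n1 d1 n2 d2 : 'I_m -> {poly F}) c :
  Bdiv n1 d1 n2 d2 c -> Bdiv n2 d2 n1 d1 (swapXY c).
Proof.
move=> h i; rewrite -[Bgen _ _ _ _ i]opprK -swapXY_Bgen; apply: rdvdN.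
by apply/swapXY_rdvd.
Qed.

(** This is f(psi(t)) = f(psi'(s)) modulo [c], with denominators cleared; it holds monomial by
    monomial because n1(t) d2(s) = n2(s) d1(t) modulo [c]. *)
Lemma hsubst_modeq {F : fieldType} {m} k (n1 d1 n2 d2 : 'I_m -> {poly F}) f c :
  (msize f <= k)%N -> Bdiv n1 d1 n2 d2 c ->
  rmodeq c ((hsubst k n1 d1 f)%:P * (\prod_i d2 i ^+ k)^:P)
           ((hsubst k n2 d2 f)^:P * (\prod_i d1 i ^+ k)%:P).
Proof.
move=> fk hc; rewrite /hsubst !rmorph_sum !mulr_suml /=.
rewrite big_seq [X in rmodeq _ _ X]big_seq.
apply: (big_ind2 (rmodeq c)) => [|*|mm fm]; [exact: rmodeq_refl | exact: rmodeqD |].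
rewrite -!mul_polyC !rmorphM /= map_polyC -!mulrA.
apply: rmodeqM; first exact: rmodeq_refl.
rewrite !rmorph_prod -!big_split /=.
apply: (big_ind2 (rmodeq c)) => [|*|i _]; [exact: rmodeq_refl | exact: rmodeqM |].
have le := msupp_exp_le i fk fm.
rewrite -(subnK le) addnK !exprD !rmorphM /= !rmorphXn /=.
set u := (k - mm i)%N; set v := mm i.
suff : rmodeq c (((n1 i)%:P * (d2 i)^:P) ^+ v * ((d1 i)%:P * (d2 i)^:P) ^+ u)
                (((n2 i)^:P * (d1 i)%:P) ^+ v * ((d1 i)%:P * (d2 i)^:P) ^+ u).
  by congr rmodeq; rewrite !exprMn; ring.
by apply: rmodeqM; [apply: rmodeqX; apply: hc | apply: rmodeq_refl].
Qed.

(** A factor t - r of [c] would force n2/d2 to be the constant point psi(r), from which P/Q could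
    not recover the parameter. *)
Lemma proper_nonconst {F : closedFieldType} {m} (n1 d1 n2 d2 : 'I_m -> {poly F}) c :
  (forall i, coprimep (n1 i) (d1 i)) -> (forall i, d2 i != 0) ->
  proper_param n2 d2 -> Bdiv n1 d1 n2 d2 c -> tprimitive c.
Proof.
move=> co d20 [P [Q [[t0 [dt0 Qt0]] PQ]]] hc r; apply/negP => /eqP cr0.
have E i : (n1 i).[r]%:P * d2 i = n2 i * (d1 i).[r]%:P.
  case: (hc i) => x hx; have : evt r (x * c) = 0 by rewrite evtM cr0 mulr0.
  rewrite -hx /evt rmorphB !rmorphM /= !swapXY_polyC !swapXY_map_polyC.
  by rewrite hornerD hornerN !hornerM !hornerP !hornerC => /eqP; rewrite subr_eq0 => /eqP.
have d1r i : (d1 i).[r] != 0.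
  apply/negP => /eqP dr; have := E i; rewrite dr polyC0 mulr0 => /eqP.
  rewrite mulf_eq0 (negbTE (d20 i)) orbF polyC_eq0 => nr.
  by have /negP := coprimep_root (co i) nr; rewrite dr.
pose v i := (n1 i).[r] / (d1 i).[r].
have psiE t : pdom d2 t -> ppt n2 d2 t =1 v.
  move=> dt i; rewrite /ppt /v; apply/eqP; rewrite eqr_div ?dt ?d1r //.
  by have /(congr1 (fun p => p.[t])) := E i; rewrite !hornerM !hornerC => <-.
have Qv : Q.@[v] != 0 by rewrite -(meval_eq Q (psiE _ dt0)).
have PQv t : pdom d2 t -> P.@[v] = t * Q.@[v].
  by move=> dt; rewrite -!(meval_eq _ (psiE _ dt)) PQ.
have : 'X * Q.@[v]%:P - P.@[v]%:P = 0 :> {poly F}.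
  apply: (@poly_cofinite0 _ _ (\prod_i d2 i)); first exact: proddom_neq0.
  by move=> t /pdomE /PQv ->; rewrite !hornerE subrr.
move/(congr1 (fun p : {poly F} => p`_1)); rewrite coefB coefMC coefX coefC coef0 /= mul1r subr0.
by move/eqP; rewrite (negbTE Qv).
Qed.

(* [s = P/Q] on the second curve, and P/Q takes the same value on the first curve
   modulo c; the denominators [d2 i], which are units modulo c up to [d1 i], are
   cleared with the Bezout relation between [n2 i] and [d2 i]. *)
Lemma proper_common_div {F : closedFieldType} {m} (n1 d1 n2 d2 : 'I_m -> {poly F}) :
  (forall i, d1 i != 0) -> (forall i, d2 i != 0) ->
  (forall i, coprimep (n2 i) (d2 i)) -> proper_param n2 d2 ->
  exists A E e w : {poly F}, exists g : {poly {poly F}},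
    [/\ e != 0, w != 0 &
     forall c, Bdiv n1 d1 n2 d2 c ->
       rdvd c (e%:P * ('X * A%:P - E%:P)) /\
       rmodeq c (A%:P * g) (w^:P * e%:P)].
Proof.
move=> d10 d20 co2 [P [Q [[t0 [dt0 Qt0]] PQ]]].
pose k := maxn (msize P) (msize Q).
have kP : (msize P <= k)%N by rewrite leq_maxl.
have kQ : (msize Q <= k)%N by rewrite leq_maxr.
pose D1 := \prod_i d1 i ^+ k; pose D2 := \prod_i d2 i ^+ k.
have D20 : D2.[t0] != 0.
  by rewrite horner_prod; apply/prodf_neq0 => i _; rewrite horner_exp expf_neq0 ?dt0.
have PQs : hsubst k n2 d2 P = 'X * hsubst k n2 d2 Q.
  apply/eqP; rewrite -subr_eq0; apply/eqP.
  apply: (@poly_cofinite0 _ _ (\prod_i d2 i)); first exact: proddom_neq0.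
  by move=> t /pdomE dt; rewrite hornerD hornerN hornerM hornerX !hsubstE // PQ // mulrA subrr.
(* [A] and [E] are the numerators of Q(psi(t)) and P(psi(t)). The second congruence is Q(psi(t)) =
   Q(psi'(s)); [w] is nonzero because Q does not vanish at psi'(t0). *)
exists (hsubst k n1 d1 Q), (hsubst k n1 d1 P), D1, (hsubst k n2 d2 Q), D2^:P.
split; first by apply/prodf_neq0 => i _; rewrite expf_neq0.
  apply: contraTneq (mulf_neq0 Qt0 D20) => w0; rewrite negbK -hsubstE //.
  by rewrite w0 horner0.
move=> c hc; split; last exact: hsubst_modeq.
have unit_d2 : exists X, rmodeq c D1%:P (D2^:P * X).
  apply: (@big_rec2 _ _ (fun x y : {poly F} => exists X, rmodeq c x%:P (y^:P * X))).
    by exists 1; rewrite !rmorph1 mulr1; apply: rmodeq_refl.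
  move=> i x y _ [X hX]; have /Bezout_eq1_coprimepP [[u v] /= uv] := co2 i.
  have hd : rmodeq c (d1 i)%:P ((d2 i)^:P * (u^:P * (n1 i)%:P + v^:P * (d1 i)%:P)).
    have uvP : u^:P * (n2 i)^:P + v^:P * (d2 i)^:P = 1.
      by rewrite -!rmorphM -rmorphD uv rmorph1.
    rewrite /rmodeq -[X in X - _]mul1r -uvP.
    have -> : (u^:P * (n2 i)^:P + v^:P * (d2 i)^:P) * (d1 i)%:P -
      (d2 i)^:P * (u^:P * (n1 i)%:P + v^:P * (d1 i)%:P) = - u^:P * Bgen n1 d1 n2 d2 i.
      by rewrite /Bgen; ring.
    by apply: rdvd_mull; apply: hc.
  exists ((u^:P * (n1 i)%:P + v^:P * (d1 i)%:P) ^+ k * X).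
  rewrite !rmorphM mulrACA !rmorphXn /= -exprMn; apply: rmodeqM => //.
  exact: rmodeqX.
have step : rdvd c (D2^:P * ('X * (hsubst k n1 d1 Q)%:P - (hsubst k n1 d1 P)%:P)).
  have hP := hsubst_modeq k n1 d1 n2 d2 P c kP hc.
  have := rmodeqM _ 'X _ _ _ (rmodeq_refl _ _) (hsubst_modeq k n1 d1 n2 d2 Q c kQ hc).
  rewrite mulrA -['X]/('X) -{2}(map_polyX polyC).
  rewrite mulrA -rmorphM -PQs /= => hQ.
  have := rdvdD _ _ _ hQ (rdvdN _ _ hP); congr rdvd.
  by rewrite /D2; ring.
case: unit_d2 => X hX.
set H := ('X * _ - _) in step *.
have -> : D1%:P * H = (D1%:P - D2^:P * X) * H + X * (D2^:P * H) by ring.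
by apply: rdvdD; [rewrite mulrC|]; apply: rdvd_mull.
Qed.

Lemma size_linXY {F : fieldType} (A E : {poly F}) :
  A != 0 -> size ('X * A%:P - E%:P) = 2.
Proof.
move=> A0; have sXA : size ('X * A%:P) = 2.
  by rewrite mulrC size_mulX ?polyC_eq0 // size_polyC A0.
rewrite size_polyDl ?sXA // size_polyN.
exact: leq_ltn_trans (size_polyC_leq1 _) _.
Qed.

Lemma tprimitive_neq0 {F : fieldType} (c : {poly {poly F}}) : tprimitive c -> c != 0.
Proof. by move=> /(_ 0); apply: contra_neq => ->; rewrite /evt rmorph0 horner0. Qed.

(** If [A] were zero, [c] would divide w(s) e(t), hence w(s) by Gauss's lemma, and so would have
    degree 0 in t. *)
Lemma rdvd_linXY {F : closedFieldType} (c : {poly {poly F}}) (A E e w : {poly F}) g :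
  e != 0 -> w != 0 -> tprimitive c -> (1 < size (swapXY c))%N ->
  rmodeq c (A%:P * g) (w^:P * e%:P) -> A != 0.
Proof.
move=> e0 w0 cp sc h; apply/eqP => A0; move: h.
rewrite A0 /rmodeq polyC0 mul0r sub0r => /rdvdN.
rewrite opprK mulrC => /(tprimitive_gauss _ _ _ e0 cp) /swapXY_rdvd.
rewrite swapXY_map_polyC => /rdvd_size; rewrite polyC_eq0 => /(_ w0).
by move/(leq_trans sc); rewrite ltnNge size_polyC_leq1.
Qed.

(** By Gauss's lemma [c] divides s A(t) - E(t), which has degree exactly one in s because [A] is
    nonzero. *)
Lemma Bdiv_size_le {F : closedFieldType} {m} (n1 d1 n2 d2 : 'I_m -> {poly F}) c :
  (forall i, d1 i != 0) -> (forall i, d2 i != 0) ->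
  (forall i, coprimep (n1 i) (d1 i)) ->
  (forall i, coprimep (n2 i) (d2 i)) -> proper_param n2 d2 ->
  Bdiv n1 d1 n2 d2 c -> (1 < size (swapXY c))%N -> (size c <= 2)%N.
Proof.
move=> d10 d20 co1 co2 pr2 hc sc.
have cp := proper_nonconst _ _ _ _ _ co1 d20 pr2 hc.
have [A [E [e [w [g [e0 w0 h]]]]]] := proper_common_div n1 d1 n2 d2 d10 d20 co2 pr2.
have [h1 h2] := h _ hc.
have A0 := rdvd_linXY c A E e w g e0 w0 cp sc h2.
have := rdvd_size (tprimitive_gauss _ _ _ e0 cp h1).
by rewrite size_linXY // -size_poly_eq0 size_linXY //; apply.
Qed.

(** A primitive polynomial free of s is a polynomial in t without roots, hence a nonzero
    constant. *)
Lemma tprimitive_size {F : closedFieldType} (c : {poly {poly F}}) :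
  tprimitive c -> ~ rdvd c 1 -> (1 < size c)%N.
Proof.
move=> cp nu; rewrite ltnNge; apply/negP => /size1_polyC ec; apply: nu.
move: (c`_0) ec => e ec.
have [/eqP/size_poly1P [x x0 ex]|/closed_rootP [r /eqP er]] := eqVneq (size e) 1%N.
  by exists (x^-1)%:P%:P; rewrite ec ex -!polyCM mulVf // !polyC1.
by have := cp r; rewrite ec evtC er polyC0 eqxx.
Qed.

(** The degree in t is bounded by exchanging the variables. Both [G] and any common divisor [c]
    divide s A(t) - E(t); comparing degrees in s, its quotient by [G] is some y(t), so [c] divides
    y(t) [G], and by primitivity [G] itself. *)
Lemma gcd_linXY {F : closedFieldType} {m} (n1 d1 n2 d2 : 'I_m -> {poly F}) (a b : {poly F}) :
  (forall i, d1 i != 0) -> (forall i, d2 i != 0) ->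
  (forall i, coprimep (n1 i) (d1 i)) -> (forall i, coprimep (n2 i) (d2 i)) ->
  proper_param n1 d1 -> proper_param n2 d2 -> b != 0 ->
  let G : {poly {poly F}} := 'X * b%:P - a%:P in
  Bdiv n1 d1 n2 d2 G ->
  [/\ size G = 2, size (swapXY G) = 2 & forall c, Bdiv n1 d1 n2 d2 c -> rdvd c G].
Proof.
move=> d10 d20 co1 co2 pr1 pr2 b0 G hG.
have sG : size G = 2 := size_linXY b a b0.
have hGs := swapXY_Bdiv _ _ _ _ _ hG.
have pG := proper_nonconst _ _ _ _ _ co1 d20 pr2 hG.
have pGs := proper_nonconst _ _ _ _ _ co2 d10 pr1 hGs.
have sGs : (1 < size (swapXY G))%N.
  apply: tprimitive_size => // /swapXY_rdvd; rewrite swapXYK rmorph1.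
  by move/rdvd_size; rewrite oner_eq0 sG size_poly1 => /(_ isT).
have sGs2 : (size (swapXY G) <= 2)%N.
  by apply: (Bdiv_size_le n2 d2 n1 d1) => //; rewrite swapXYK sG.
split=> //; first by apply/eqP; rewrite eqn_leq sGs sGs2.
move=> c hc.
have [A [E [e [w [g [e0 w0 h]]]]]] := proper_common_div n1 d1 n2 d2 d10 d20 co2 pr2.
have [h1 h2] := h _ hG.
have A0 := rdvd_linXY G A E e w g e0 w0 pG sGs h2.
have [x hx] := tprimitive_gauss _ _ _ e0 pG h1.
have H0 : 'X * A%:P - E%:P != 0 by rewrite -size_poly_eq0 size_linXY.
have := H0; rewrite hx mulf_eq0 negb_or => /andP[x0 G0].
have sx : (size x <= 1)%N.
  have := size_linXY A E A0; rewrite hx size_mul // sG addn2 /= => -[->] //.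
have ex := size1_polyC sx; move: (x`_0) ex => y ex; subst x.
have y0 : y != 0 by rewrite -polyC_eq0.
have pc := proper_nonconst _ _ _ _ _ co1 d20 pr2 hc.
have [hc1 _] := h _ hc.
apply: (tprimitive_gauss _ _ y y0 pc); rewrite -hx.
exact: (tprimitive_gauss _ _ e e0 pc hc1).
Qed.

(** * Conjugate parametrizations *)

Lemma meval_conj {F : fieldType} {m} (s : {rmorphism F -> F}) (P : {mpoly F[m]}) v :
  (map_mpoly s P).@[s \o v] = s P.@[v].
Proof.
have := mpolyE P; set r := msupp P => e; rewrite e; clearbody r.
rewrite (raddf_sum (map_mpoly s)) (raddf_sum (meval _)) (raddf_sum (meval _)) rmorph_sum /=.
apply: eq_bigr => mm _.
rewrite map_mpolyZ map_mpolyX !mevalZ !mevalX rmorphM rmorph_prod.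
by congr (_ * _); apply: eq_bigr => i _; rewrite rmorphXn.
Qed.

Lemma mpolyOver_msupp {F : fieldType} {m} (K : {pred F}) (P : {mpoly F[m]}) mm :
  P \is a mpolyOver m K -> mm \in msupp P -> P@_mm \in K.
Proof. by move=> /allP PK mP; apply: PK; apply: map_f. Qed.

Lemma meval_fixed {F : fieldType} {m} (K : {pred F}) (s : {rmorphism F -> F}) (P : {mpoly F[m]}) v :
  {in K, forall x, s x = x} -> P \is a mpolyOver m K -> P.@[s \o v] = s P.@[v].
Proof.
move=> sK PK; rewrite !mevalE rmorph_sum /=.
apply: eq_big_seq => mm /(mpolyOver_msupp K P mm PK) cK.
rewrite rmorphM sK // rmorph_prod; congr (_ * _).
by apply: eq_bigr => i _; rewrite rmorphXn.
Qed.

Lemma pdom_conj {F : fieldType} {m} (s : {rmorphism F -> F}) (d : 'I_m -> {poly F}) t :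
  pdom (fun i => map_poly s (d i)) (s t) <-> pdom d t.
Proof. by split=> h i; have := h i; rewrite horner_map fmorph_eq0. Qed.

Lemma ppt_conj {F : fieldType} {m} (s : {rmorphism F -> F}) (n d : 'I_m -> {poly F}) t :
  ppt (fun i => map_poly s (n i)) (fun i => map_poly s (d i)) (s t) =1 s \o ppt n d t.
Proof. by move=> i; rewrite /ppt /= !horner_map fmorph_div. Qed.

(** The conjugate of P/Q is the inverse; surjectivity of [s] makes every parameter a conjugate. *)
Lemma proper_conj {F : fieldType} {m} (s : {rmorphism F -> F}) (n d : 'I_m -> {poly F}) :
  bijective s -> proper_param n d ->
  proper_param (fun i => map_poly s (n i)) (fun i => map_poly s (d i)).
Proof.
case=> s' sK s'K [P [Q [[t0 [dt0 Q0]] PQ]]].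
exists (map_mpoly s P), (map_mpoly s Q); split.
  exists (s t0); split; first exact/pdom_conj.
  by rewrite (meval_eq _ (ppt_conj s n d t0)) meval_conj fmorph_eq0.
move=> t; rewrite -(s'K t) => /pdom_conj dt.
by rewrite !(meval_eq _ (ppt_conj s n d (s' t))) !meval_conj PQ // rmorphM.
Qed.

(** * Linear divisors and the relation on the hypercircle *)

Lemma psubst_meval {F : fieldType} {n} (p : {poly F}) (a : F) (x : 'I_n -> F) :
  (psubst p (alpha_sub n a)).@[x] = p.[\sum_(i < n) a ^+ i * x i].
Proof.
rewrite /psubst; elim/poly_ind: p => [|p c IH]; first by rewrite rmorph0 !horner0 meval0.
rewrite rmorphD rmorphM /= map_polyX map_polyC /= !hornerMXaddC mevalD mevalM IH mevalC.
congr (_ * _ + _); rewrite raddf_sum; apply: eq_bigr => i _.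
by rewrite /= mevalZ mevalXU.
Qed.

(* A specialization [s := a/b] killing [P] makes [b s - a] a pseudo-divisor of [P];
   the power of [b] is removed by primitivity. *)
Lemma linXY_rdvd {F : closedFieldType} (P : {poly {poly F}}) (a b c : {poly F}) :
  coprimep a b -> b != 0 -> c != 0 ->
  (forall t, c.[t] != 0 -> b.[t] != 0 -> (evt t P).[a.[t] / b.[t]] = 0) ->
  rdvd ('X * b%:P - a%:P) P.
Proof.
move=> co b0 c0 hP; set G := 'X * b%:P - a%:P.
have sG : size G = 2 := size_linXY b a b0.
have lG : lead_coef G = b.
  by rewrite lead_coefE sG /= coefB coefXM coefC /= coefC subr0.
have pG : tprimitive G.
  move=> r; apply/negP => /eqP G0.
  have := evt_coef r G 0; rewrite G0 coef0 coefB coefXM !coefC /= sub0r hornerN => /esym/eqP.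
  rewrite oppr_eq0 => ar; have := coprimep_root co ar.
  have := evt_coef r G 1; rewrite G0 coef0 coefB coefXM !coefC /= subr0 => <-.
  by rewrite eqxx.
have := Pdiv.Idomain.divp_eq P G; set k := scalp P G; set q := (P %/ G)%R; set r := (P %% G)%R.
have sr : (size r <= 1)%N.
  by have := ltn_modp P G; rewrite -size_poly_eq0 sG.
rewrite lG -mul_polyC (size1_polyC sr); move: (r`_0) => r0 eqP.
(* The remainder depends on t alone, and substituting s = a/b shows that it vanishes at every t
   where [c] and [b] do not. *)
have r00 : r0 = 0.
  apply: (@poly_cofinite0 _ _ (c * b)); first by rewrite mulf_neq0.
  move=> t; rewrite hornerM mulf_eq0 negb_or => /andP[ct bt].
  have := congr1 (fun p => (evt t p).[a.[t] / b.[t]]) eqP.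
  rewrite /= evtD !evtM !hornerD !hornerM hP // mulr0.
  have -> : (evt t G).[a.[t] / b.[t]] = 0.
    rewrite /G evtD evtN evtM evtX !evtC hornerD hornerN hornerM hornerX !hornerC.
    by rewrite divfK // subrr.
  by rewrite mulr0 add0r evtC hornerC.
apply: (tprimitive_gauss _ _ (b ^+ k)); rewrite ?expf_neq0 //.
by rewrite eqP r00 addr0; exists q.
Qed.

(** Where the F_il with i > 0 vanish, \sum_i a^i F_il does not depend on a. With a = alpha and a =
    s(alpha), both sides of psi_l(y0) = psi_l^s(yj) equal F_0l/D. With denominators cleared this is
    a polynomial identity, so it passes to the Zariski closure. *)
Lemma hyper_relation {F : fieldType} (K : {pred F}) {n m} (alpha : F) (s : {rmorphism F -> F})
    (nn dd : 'I_m -> {poly F}) (Fil : 'I_n -> 'I_m -> {mpoly F[n]}) (D : {mpoly F[n]}) x l :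
  bijective s -> {in K, forall x, s x = x} ->
  hyper_decomp K alpha nn dd Fil D -> zclosure (hyper_W Fil D) x ->
  let y0 := \sum_(i < n) alpha ^+ i * x i in
  let yj := \sum_(i < n) (s alpha) ^+ i * x i in
  (nn l).[y0] * (map_poly s (dd l)).[yj] = (map_poly s (nn l)).[yj] * (dd l).[y0].
Proof.
move=> [s' sK s'K] fixK [D0 DK FK dec] hx y0 yj.
pose E := psubst (nn l) (alpha_sub n alpha) * psubst (map_poly s (dd l)) (alpha_sub n (s alpha))
  - psubst (map_poly s (nn l)) (alpha_sub n (s alpha)) * psubst (dd l) (alpha_sub n alpha).
suff /eqP : E.@[x] = 0.
  by rewrite mevalB !mevalM !psubst_meval subr_eq0 => /eqP.
apply: hx => {y0 yj}x [Dx Fx]; rewrite mevalB !mevalM !psubst_meval.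
set y0 := \sum_(i < n) _; set yj := \sum_(i < n) _.
have [f0 hf0] : exists f, forall a, \sum_(i < n) a ^+ i * (Fil i l).@[x] = f :> F.
  have [i0 i00|no] := pickP (fun i : 'I_n => nat_of_ord i == 0).
    exists (Fil i0 l).@[x] => a; rewrite (bigD1 i0) //= (eqP i00) mul1r big1 ?addr0 //.
    by move=> i; rewrite -val_eqE /= (eqP i00) -lt0n => /Fx ->; rewrite mulr0.
  by exists 0 => a; rewrite big1 // => i _; rewrite Fx ?mulr0 // lt0n no.
have evF a v : (\sum_(i < n) a ^+ i *: Fil i l).@[v] = \sum_(i < n) a ^+ i * (Fil i l).@[v].
  by rewrite raddf_sum; apply: eq_bigr => i _; rewrite /= mevalZ.
have E1 : (nn l).[y0] * D.@[x] = (dd l).[y0] * f0.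
  by have /(congr1 (fun p => p.@[x])) := dec l; rewrite !mevalM !psubst_meval evF hf0.
(* The decomposition is evaluated at s^(-1)(x) and [s] is applied: as [D] and the F_il have
   coefficients in [K], their values at x come back, while alpha becomes s(alpha). *)
have E2 : (map_poly s (nn l)).[yj] * D.@[x] = (map_poly s (dd l)).[yj] * f0.
  have xE : s \o (s' \o x) =1 x by move=> i; apply: s'K.
  have /(congr1 (fun p => s p.@[s' \o x])) := dec l.
  rewrite !mevalM !psubst_meval evF !rmorphM /= -!horner_map.
  rewrite -(meval_fixed K) // (meval_eq _ xE).
  have -> : s (\sum_(i < n) alpha ^+ i * (s' \o x) i) = yj.
    by rewrite rmorph_sum; apply: eq_bigr => i _; rewrite rmorphM rmorphXn /= s'K.
  move=> ->; congr (_ * _); rewrite rmorph_sum -(hf0 (s alpha)); apply: eq_bigr => i _.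
  by rewrite rmorphM rmorphXn /= -(meval_fixed K) // (meval_eq _ xE).
apply: (mulIf Dx); rewrite mul0r mulrBl -mulrA (mulrC _ D.@[x]) mulrA E1.
by rewrite [X in _ - X]mulrAC E2; ring.
Qed.

(** * Descent of the equations of a parametrized set *)

Definition vanishes_on {F : fieldType} {m} (nn dd : 'I_m -> {poly F}) (f : {mpoly F[m]}) : Prop :=
  forall t, pdom dd t -> f.@[ppt nn dd t] = 0.

Lemma hsubst_eq0 {F : fieldType} {m} {nn dd : 'I_m -> {poly F}} {f} :
  hsubst (msize f) nn dd f = 0 -> vanishes_on nn dd f.
Proof.
move=> N0 t dt; have := hsubstE _ nn dd f t (leqnn _) dt; rewrite N0 horner0.
have nz : (\prod_i dd i ^+ msize f).[t] != 0.
  by rewrite horner_prod; apply/prodf_neq0 => i _; rewrite horner_exp expf_neq0 ?dt.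
by move/esym/eqP; rewrite mulf_eq0 (negbTE nz) orbF => /eqP.
Qed.

Lemma vanishes_on_cofinite {F : closedFieldType} {m} {nn dd : 'I_m -> {poly F}} f (q : {poly F}) :
  (forall i, dd i != 0) -> q != 0 ->
  (forall t, pdom dd t -> q.[t] != 0 -> f.@[ppt nn dd t] = 0) -> vanishes_on nn dd f.
Proof.
move=> dd0 q0 h.
have N0 : hsubst (msize f) nn dd f = 0.
  apply: (@poly_cofinite0 _ _ (q * \prod_i dd i)).
    by rewrite mulf_neq0 // proddom_neq0.
  move=> t; rewrite hornerM mulf_eq0 negb_or => /andP[qt /pdomE dt].
  by rewrite hsubstE // h // mul0r.
exact: hsubst_eq0 N0.
Qed.

Lemma poly_nat_roots {F : fieldType} (p : {poly F}) :
  [pchar F] =i pred0 -> (forall k : nat, p.[k%:R] = 0) -> p = 0.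
Proof.
move=> /pcharf0P ch0 h; apply/eqP; apply: contraT => p0.
have : (size [seq (k%:R : F) | k <- iota 0 (size p)] < size p)%N.
  apply: max_poly_roots => //.
    by apply/allP => _ /mapP[k _ ->]; rewrite /root h.
  rewrite map_inj_in_uniq ?iota_uniq // => i j _ _; wlog le : i j / (i <= j)%N.
    by move=> H e; case/orP: (leq_total i j) => [/H ->|/H <-].
  move=> /esym/eqP; rewrite -subr_eq0 -natrB // ch0 subn_eq0 => le'.
  by apply/eqP; rewrite eqn_leq le le'.
by rewrite size_map size_iota ltnn.
Qed.

(** Natural numbers lie in [K], so non-vanishing is detected at a point with coordinates in K(alpha)
    when psi is defined over K(alpha). *)
Lemma vanishes_on_nat {F : fieldType} {m} {nn dd : 'I_m -> {poly F}} f :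
  [pchar F] =i pred0 -> (forall i, dd i != 0) ->
  (forall k : nat, pdom dd k%:R -> f.@[ppt nn dd k%:R] = 0) -> vanishes_on nn dd f.
Proof.
move=> ch0 dd0 h.
have /eqP : hsubst (msize f) nn dd f * \prod_i dd i = 0.
  apply: poly_nat_roots => // k; rewrite hornerM.
  have [->|/pdomE dk] := eqVneq (\prod_i dd i).[k%:R] 0; first by rewrite mulr0.
  by rewrite hsubstE // h // !mul0r.
rewrite mulf_eq0 (negbTE (proddom_neq0 _ dd0)) orbF => /eqP N0.
exact: hsubst_eq0 N0.
Qed.

Section Descent.

Variables (F : closedFieldType) (K : {pred F}) (alpha : F) (n : nat).
Hypothesis KP : GRing.divring_closed K.
Hypothesis algF : forall x : F, exists p : {poly F}, [/\ p \is a polyOver K, p != 0 & root p x].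
Hypothesis degA : alg_degree K alpha n.

HB.instance Definition _ := GRing.isDivringClosed.Build F K KP.

(** * The field K(alpha) *)

Let L := in_Kalpha K alpha.

Lemma KalphaC x : x \in K -> L x.
Proof. by move=> xK; exists x%:P; rewrite polyOverC hornerC. Qed.

Lemma KalphaD x y : L x -> L y -> L (x + y).
Proof. by case=> p [pK ->] [q [qK ->]]; exists (p + q); rewrite hornerD rpredD. Qed.

Lemma KalphaM x y : L x -> L y -> L (x * y).
Proof. by case=> p [pK ->] [q [qK ->]]; exists (p * q); rewrite hornerM rpredM. Qed.

Lemma KalphaX x k : L x -> L (x ^+ k).
Proof. by case=> p [pK ->]; exists (p ^+ k); rewrite horner_exp rpredX. Qed.

Lemma Kalpha_sum I (r : seq I) (P : pred I) (f : I -> F) :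
  (forall i, L (f i)) -> L (\sum_(i <- r | P i) f i).
Proof.
by move=> h; apply: big_ind => //; [exact: KalphaC (rpred0 _) | exact: KalphaD].
Qed.

Lemma Kalpha_prod I (r : seq I) (P : pred I) (f : I -> F) :
  (forall i, L (f i)) -> L (\prod_(i <- r | P i) f i).
Proof.
by move=> h; apply: big_ind => //; [exact: KalphaC (rpred1 _) | exact: KalphaM].
Qed.

Lemma Kalpha_horner p x : coefs_in L p -> L x -> L p.[x].
Proof.
move=> pL xL; rewrite horner_coef; apply: Kalpha_sum => i.
by apply: KalphaM => //; apply: KalphaX.
Qed.

(** An equation x p(x) + c = 0 over [K] gives x^(-1) = - p(x)/c if c is nonzero; otherwise p(x) = 0
    is a shorter equation. *)
Lemma KalphaV x : L x -> L x^-1.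
Proof.
move=> xL; have [->|x0] := eqVneq x 0; first by rewrite invr0; apply: KalphaC; apply: rpred0.
have [p [pK p0 px]] := algF x; elim/poly_ind: p => [|p c IH] in pK p0 px *.
  by rewrite eqxx in p0.
have cE i : p`_i \in K.
  by have /polyOverP/(_ i.+1) := pK; rewrite coefD coefMX coefC /= addr0.
have cK : c \in K by have /polyOverP/(_ 0) := pK; rewrite coefD coefMX coefC /= add0r.
move: px; rewrite /root hornerMXaddC; have [c0|c0] := eqVneq c 0.
  rewrite c0 addr0 mulf_eq0 (negbTE x0) orbF => px; apply: IH => //; first exact/polyOverP.
  by apply: contra_neq p0 => ->; rewrite c0 mul0r add0r.
rewrite addrC addr_eq0 => /eqP cpx.
have -> : x^-1 = - c^-1 * p.[x].
  by apply: (mulIf x0); rewrite -mulrA mulNr mulVf // -mulrN -cpx mulVf.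
apply: KalphaM; first by apply: KalphaC; rewrite rpredN rpredV.
by apply: Kalpha_horner => // i; apply: KalphaC.
Qed.

Lemma Kalpha_ppt {m} (nn dd : 'I_m -> {poly F}) t i :
  (forall i, coefs_in L (nn i)) -> (forall i, coefs_in L (dd i)) -> t \in K ->
  L (ppt nn dd t i).
Proof.
move=> nL dL tK; apply: KalphaM; first by apply: Kalpha_horner => //; apply: KalphaC.
by apply: KalphaV; apply: Kalpha_horner => //; apply: KalphaC.
Qed.

(** * Equations over K(alpha) and their components over K *)

Definition Kdec {m} (f : {mpoly F[m]}) : Prop :=
  exists g : nat -> {mpoly F[m]}, (forall i, g i \is a mpolyOver m K) /\
    f = \sum_(i < n) alpha ^+ i *: g i.

Lemma Kdec_pow : exists2 c : nat -> F, (forall i, c i \in K) &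
  (0 < n)%N /\ alpha ^+ n = \sum_(i < n) c i * alpha ^+ i.
Proof.
case: degA => -[p [/polyOverP pK pm sp pr] _].
exists (fun i => - p`_i) => [i|]; first by rewrite rpredN.
split.
  rewrite lt0n; apply/eqP => n0; move: pr pm; rewrite n0 in sp.
  rewrite (size1_polyC (eq_leq sp)) rootC => /eqP ->.
  by rewrite monicE lead_coefC eq_sym oner_eq0.
move: pr; rewrite /root horner_coef sp big_ord_recr /=.
have -> : p`_n = 1 by move/monicP: pm; rewrite lead_coefE sp.
rewrite mul1r addrC addr_eq0 => /eqP ->; rewrite -sumrN.
by apply: eq_bigr => i _; rewrite mulNr.
Qed.

Lemma KdecD {m} (f g : {mpoly F[m]}) : Kdec f -> Kdec g -> Kdec (f + g).
Proof.
case=> a [aK ->] [b [bK ->]]; exists (fun i => a i + b i); split.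
  by move=> i; rewrite rpredD.
by rewrite -big_split; apply: eq_bigr => i _; rewrite scalerDr.
Qed.

Lemma KdecZK {m} (f : {mpoly F[m]}) x : x \in K -> Kdec f -> Kdec (x *: f).
Proof.
move=> xK [a [aK ->]]; exists (fun i => x *: a i); split.
  by move=> i; rewrite mpolyOverZ.
by rewrite scaler_sumr; apply: eq_bigr => i _; rewrite !scalerA mulrC.
Qed.

Lemma KdecZalpha {m} (f : {mpoly F[m]}) : Kdec f -> Kdec (alpha *: f).
Proof.
have [c cK [n0 an]] := Kdec_pow.
(* Multiplication by alpha shifts the components; the top one, now at alpha^n, is redistributed by
   the minimal equation. *)
case=> a [aK ->]; exists (fun i => (if i is j.+1 then a j else 0) + c i *: a n.-1); split.
  move=> i; rewrite rpredD ?mpolyOverZ //; case: i => [|i] //.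
  exact: rpred0.
under [RHS]eq_bigr do rewrite scalerDr.
rewrite big_split /=; have -> : \sum_(i < n) alpha ^+ i *: (c i *: a n.-1) = alpha ^+ n *: a n.-1.
  by rewrite an scaler_suml; apply: eq_bigr => i _; rewrite scalerA mulrC.
case: (n) n0 => // k _; rewrite scaler_sumr big_ord_recr /= big_ord_recl /= scaler0 add0r.
rewrite !scalerA -exprS; congr (_ + _); apply: eq_bigr => i _.
by rewrite scalerA -exprS.
Qed.

Lemma KdecZ {m} (f : {mpoly F[m]}) x : L x -> Kdec f -> Kdec (x *: f).
Proof.
case=> p [/polyOverP pK ->] fK; rewrite horner_coef scaler_suml.
apply: big_ind => [|*|i _]; [|exact: KdecD|].
  exists (fun=> 0); split=> [i|]; first exact: rpred0.
  by rewrite big1 // => i _; rewrite scaler0.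
rewrite -scalerA; apply: KdecZK => //.
elim: (val i) => [|k IH]; first by rewrite expr0 scale1r.
by rewrite exprS -scalerA; apply: KdecZalpha.
Qed.

Lemma KdecX {m} (mm : 'X_{1..m}) : Kdec ('X_[mm] : {mpoly F[m]}).
Proof.
have [c cK [n0 _]] := Kdec_pow.
exists (fun i => if i is 0 then 'X_[mm] else 0); split.
  by case=> [|i]; [exact: mpolyOverX | exact: rpred0].
case: (n) n0 => // k _; rewrite big_ord_recl expr0 scale1r big1 ?addr0 //.
by move=> i _; rewrite scaler0.
Qed.

Lemma Kdec_eval {m} (f : {mpoly F[m]}) v : Kdec f -> (forall i, L (v i)) -> L f.@[v].
Proof.
case=> g [gK ->] vL; rewrite raddf_sum /=; apply: Kalpha_sum => i.
rewrite mevalZ; apply: KalphaM.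
  by apply: KalphaX; exists 'X; rewrite polyOverX hornerX.
rewrite mevalE; apply: Kalpha_sum => mm; apply: KalphaM.
  by apply: KalphaC; apply: mpolyOverP.
by apply: Kalpha_prod => l; apply: KalphaX.
Qed.

(* Write an equation as a sum of terms [e *: g] with [g] over [K(alpha)].  If some [g]
   does not vanish on the set, it is nonzero at some parameter [t] in [K] (as [K] is
   infinite); evaluating there gives a linear relation between the [e]'s over
   [K(alpha)], which shortens the sum. *)
Lemma vanishes_descent {m} (nn dd : 'I_m -> {poly F}) (x : 'I_m -> F) :
  [pchar F] =i pred0 -> (forall i, dd i != 0) ->
  (forall i, coefs_in L (nn i)) -> (forall i, coefs_in L (dd i)) ->
  (forall f, Kdec f -> vanishes_on nn dd f -> f.@[x] = 0) ->
  forall f, vanishes_on nn dd f -> f.@[x] = 0.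
Proof.
move=> ch0 dd0 nL dL hx f.
have key s : (forall y : F * {mpoly F[m]}, y \in s -> Kdec y.2) ->
    vanishes_on nn dd (\sum_(y <- s) y.1 *: y.2) -> (\sum_(y <- s) y.1 *: y.2).@[x] = 0.
  elim: {s}(size s) {-2}s (erefl (size s)) => [|k IH] s.
    by move/size0nil=> -> _ _; rewrite big_nil meval0.
  move=> ss sK sI.
  have [all_van|] := classic (forall y, y \in s -> vanishes_on nn dd y.2).
    rewrite raddf_sum big1_seq //= => y ys.
    by rewrite mevalZ hx ?mulr0 //; [exact: sK | exact: all_van].
  move=> nall; have [y yP] := not_all_ex_not _ _ nall.
  have [ys yI] := imply_to_and _ _ yP.
  have [t [tK dt yt]] : exists t, [/\ t \in K, pdom dd t & y.2.@[ppt nn dd t] != 0].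
    apply: NNPP => no; apply: yI; apply: vanishes_on_nat => // i di.
    apply: NNPP => /eqP yi; apply: no; exists i%:R; split=> //.
    exact: rpred_nat.
  set la := y.2.@[ppt nn dd t] in yt.
  (* Evaluation at [t] gives y.1 = - \sum_z z.1 z.2(t) / la over the other terms; substituting this
     eliminates [y]. *)
  pose s' := [seq (z.1, z.2 - (z.2.@[ppt nn dd t] / la) *: y.2) | z <- rem y s].
  have evL g : Kdec g -> L g.@[ppt nn dd t].
    by move=> gK; apply: Kdec_eval => // i; apply: Kalpha_ppt.
  have sE : \sum_(y <- s) y.1 *: y.2 = \sum_(z <- s') z.1 *: z.2.
    have := sI t dt; rewrite !(perm_big _ (perm_to_rem ys)) /= !big_cons.
    rewrite mevalD mevalZ -/la raddf_sum => /eqP; rewrite addr_eq0 => /eqP e.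
    rewrite big_map /=; under [RHS]eq_bigr do rewrite scalerBr.
    rewrite sumrB addrC; congr (_ + _); rewrite -[y.1](mulfK yt) e.
    rewrite mulNr scaleNr; congr (- _); rewrite mulr_suml scaler_suml.
    by apply: eq_bigr => z _; rewrite /= mevalZ scalerA mulrA.
  rewrite sE in sI *; apply: IH => //.
    by rewrite size_map size_rem // ss.
  move=> _ /mapP[z /mem_rem zs ->] /=; apply: KdecD; first exact: sK.
  rewrite -scaleNr; apply: KdecZ; last exact: sK.
  rewrite -mulN1r; apply: KalphaM; first by apply: KalphaC; rewrite rpredN rpred1.
  by apply: KalphaM; [|apply: KalphaV]; apply: evL; apply: sK.
move=> fI; have fE : f = \sum_(y <- [seq (f@_mm, 'X_[mm]) | mm <- msupp f]) y.1 *: y.2.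
  by rewrite big_map -mpolyE.
rewrite fE; apply: key; last by rewrite -fE.
by move=> _ /mapP[mm _ ->]; apply: KdecX.
Qed.

(** * Conjugate equations and descent to K *)

(** Injectivity of the Vandermonde system: a polynomial of degree less than n with n distinct roots
    is zero. *)
Lemma conj_roots_coef {I : finType} (a : I -> F) (c : nat -> F) :
  injective a -> #|I| = n -> (forall j, \sum_(i < n) a j ^+ i * c i = 0) ->
  forall i, (i < n)%N -> c i = 0.
Proof.
move=> ainj cI h i lt; pose p := \poly_(i < n) c i.
have p0 : p = 0.
  apply/eqP; apply: contraT => p0.
  have : (size [seq a j | j <- enum I] < size p)%N.
    apply: max_poly_roots => //; last by rewrite map_inj_uniq ?enum_uniq.
    apply/allP => _ /mapP[j _ ->]; apply/eqP; rewrite horner_poly -[RHS](h j).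
    by apply: eq_bigr => l _; rewrite mulrC.
  by rewrite size_map -cardE cI ltnNge size_poly.
by have := coef_poly n c i; rewrite -/p p0 coef0 lt.
Qed.

(** A root u of c(t, s) in s gives psi(t) = psi^s(u) = s(psi(s^(-1)(u))). Hence the conjugate
    equation at psi(t) is the image under [s] of the original equation at psi(s^(-1)(u)). *)
Lemma conj_vanishes {m} (nn dd : 'I_m -> {poly F}) (s : {rmorphism F -> F}) c
    (g : nat -> {mpoly F[m]}) :
  bijective s -> {in K, forall x, s x = x} ->
  (forall i, dd i != 0) -> (forall i, coprimep (nn i) (dd i)) -> proper_param nn dd ->
  Bdiv nn dd (fun i => map_poly s (nn i)) (fun i => map_poly s (dd i)) c -> ~ rdvd c 1 ->
  (forall i, g i \is a mpolyOver m K) ->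
  vanishes_on nn dd (\sum_(i < n) alpha ^+ i *: g i) ->
  vanishes_on nn dd (\sum_(i < n) (s alpha) ^+ i *: g i).
Proof.
move=> sbij sK dd0 co pr hc nu gK gI; have [s' ss' s's] := sbij.
have d20 i : map_poly s (dd i) != 0 by rewrite map_poly_eq0.
have cp := proper_nonconst _ _ _ _ _ co d20 (proper_conj _ _ _ sbij pr) hc.
have sc := tprimitive_size _ cp nu.
have lc0 : lead_coef c != 0 by rewrite lead_coef_eq0 tprimitive_neq0.
(* Away from the zeros of the leading coefficient, c(t, s) keeps its positive degree in s and
   therefore has a root. *)
apply: (vanishes_on_cofinite _ (lead_coef c)) => // t dt lt.
have /closed_rootP [u /eqP ru] : size (evt t c) != 1%N.
  have : (evt t c)`_(size c).-1 != 0 by rewrite evt_coef -lead_coefE.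
  apply: contra_neq => e1; rewrite nth_default // e1 -ltnS prednK //.
  exact: leq_trans sc.
have E i : (nn i).[t] * (map_poly s (dd i)).[u] = (map_poly s (nn i)).[u] * (dd i).[t].
  case: (hc i) => x hx; have : (evt t (x * c)).[u] = 0 by rewrite evtM hornerM ru mulr0.
  rewrite -hx /Bgen evtD evtN !evtM !evtC !evtP hornerD hornerN !hornerM !hornerC.
  by move/eqP; rewrite subr_eq0 => /eqP.
have du : pdom (fun i => map_poly s (dd i)) u.
  move=> i; apply/negP => /eqP du; have := E i; rewrite du mulr0 => /esym/eqP.
  rewrite mulf_eq0 (negbTE (dt i)) orbF => nu0.
  have : coprimep (map_poly s (nn i)) (map_poly s (dd i)) by rewrite coprimep_map.
  by move/coprimep_root => /(_ _ nu0); rewrite du eqxx.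
have tu : ppt nn dd t =1 s \o ppt nn dd (s' u).
  move=> i; rewrite -ppt_conj s's /ppt; apply/eqP.
  by rewrite (eqr_div _ _ (dt i) (du i)) E.
have du' : pdom dd (s' u) by apply/(pdom_conj s); rewrite s's.
apply: etrans (etrans (congr1 s (gI _ du')) (rmorph0 s)).
rewrite (raddf_sum (meval _)) (raddf_sum (meval _)) rmorph_sum /=.
apply: eq_bigr => i _; rewrite !mevalZ rmorphM rmorphXn /=; congr (_ * _).
by rewrite (meval_eq _ tu) (meval_fixed K).
Qed.

(** The equations over [K] that vanish on the curve cut it out: descent reduces any equation to one
    over K(alpha), whose components over [K] vanish on the curve since all its conjugates do. *)
Lemma defined_over_of_conj {m} (nn dd : 'I_m -> {poly F}) (sigma : 'I_n -> {rmorphism F -> F}) :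
  [pchar F] =i pred0 -> (forall i, dd i != 0) ->
  (forall i, coefs_in L (nn i)) -> (forall i, coefs_in L (dd i)) ->
  injective (fun j => sigma j alpha) ->
  (forall j (g : nat -> {mpoly F[m]}), (forall i, g i \is a mpolyOver m K) ->
     vanishes_on nn dd (\sum_(i < n) alpha ^+ i *: g i) ->
     vanishes_on nn dd (\sum_(i < n) (sigma j alpha) ^+ i *: g i)) ->
  defined_over K (pcurve nn dd).
Proof.
move=> ch0 dd0 nL dL sinj hs.
exists (fun f => f \is a mpolyOver m K /\ vanishes_on nn dd f); split; first by move=> f [].
move=> x; split=> [hx f [_ fI]|hx].
  by apply: hx => _ [t [dt ->]]; apply: fI.
have main := vanishes_descent nn dd x ch0 dd0 nL dL.
move=> f fI; apply: main => [|t dt]; last by apply: fI; exists t.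
move=> {fI}f [g [gK ->]] gI.
have gv i : (i < n)%N -> vanishes_on nn dd (g i).
  move=> lt t dt; apply: (conj_roots_coef (fun j => sigma j alpha) (fun i => (g i).@[ppt nn dd t])) => //.
    exact: card_ord.
  move=> j; rewrite -[RHS](hs j g gK gI t dt) (raddf_sum (meval _)).
  by apply: eq_bigr => l _; rewrite /= mevalZ.
rewrite raddf_sum big1 //= => i _; rewrite mevalZ hx ?mulr0 //; split=> //.
exact: gv.
Qed.

End Descent.

(** * Greatest common divisors and the field of definition *)

Theorem theorem2
  (F : closedFieldType) (K : {pred F}) (n m : nat) (alpha : F)
  (sigma : 'I_n -> {rmorphism F -> F}) (nn dd : 'I_m -> {poly F}) :
  (* K is a subfield of F of characteristic zero, and F is algebraic over K *)
  GRing.divring_closed K ->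
  [pchar F] =i pred0 ->
  (forall x : F, exists p : {poly F}, [/\ p \is a polyOver K, p != 0 & root p x]) ->
  (* alpha algebraic of degree n over K *)
  alg_degree K alpha n ->
  (* sigma_j are K-automorphisms of F, sigma_0 = Id, alpha_j = sigma_j(alpha) distinct *)
  (forall j, bijective (sigma j)) ->
  (forall j, {in K, forall x, sigma j x = x}) ->
  (forall j : 'I_n, nat_of_ord j = 0%N -> forall x, sigma j x = x) ->
  injective (fun j => sigma j alpha) ->
  (* psi_i = n_i/d_i in K(alpha)(t), reduced, and psi is proper *)
  (forall i, coefs_in (in_Kalpha K alpha) (nn i)) ->
  (forall i, coefs_in (in_Kalpha K alpha) (dd i)) ->
  (forall i, dd i != 0) ->
  (forall i, coprimep (nn i) (dd i)) ->
  proper_param nn dd ->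
  (* (1) *)
  (defined_over K (pcurve nn dd) ->
     forall (Fil : 'I_n -> 'I_m -> {mpoly F[n]}) (D : {mpoly F[n]})
            (U : ('I_n -> F) -> Prop) (p q : 'I_n -> {poly F}),
       hyper_decomp K alpha nn dd Fil D ->
       hypercircle Fil D U ->
       standard_param alpha U p q ->
       forall (j : 'I_n), (0 < j)%N ->
       forall a b : {poly F}, coprimep a b -> b != 0 ->
         (forall t, pdom q t -> b.[t] * u_fun (sigma j alpha) p q t = a.[t]) ->
         let G : {poly {poly F}} := 'X * b%:P - a%:P in
         [/\ size G = 2%N, size (swapXY G) = 2%N & is_gcd (Bset (sigma j) nn dd) G])
  /\
  (* (2) *)
  (~ defined_over K (pcurve nn dd) ->
     exists j : 'I_n, (0 < j)%N /\ is_gcd (Bset (sigma j) nn dd) 1).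
Proof.
move=> KP ch0 algF degA sbij sfix s0 sinj nL dL dd0 co pr.
have cosig j i : coprimep (map_poly (sigma j) (nn i)) (map_poly (sigma j) (dd i)).
  by rewrite coprimep_map.
have d0sig j i : map_poly (sigma j) (dd i) != 0 by rewrite map_poly_eq0.
split.
  move=> _ Fil D U p q dec [[_ UW _] _] [Up [_ [_ [[t0 [dt0 _]] _]]] sp] j j0 a b cab b0 hab G.
  have q0 : \prod_i q i != 0.
    by move/pdomE: dt0; apply: contraNneq => ->; rewrite horner0.
  (* The substitution s = u_j(t) = a/b kills every B_l by the relation on the hypercircle. *)
  have GB : Bdiv nn dd (fun i => map_poly (sigma j) (nn i))
                       (fun i => map_poly (sigma j) (dd i)) G.
    move=> l; apply: (linXY_rdvd _ _ _ (\prod_i q i)) => // t /pdomE qt bt.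
    have Ut : U (ppt p q t).
      by apply/Up => f hf; apply: hf; exists t.
    have /= := hyper_relation K alpha (sigma j) nn dd Fil D _ l (sbij j) (sfix j) dec (UW _ Ut).
    rewrite sp // -/(u_fun _ p q t).
    have -> : u_fun (sigma j alpha) p q t = a.[t] / b.[t].
      by rewrite -hab // mulrC mulKf.
    move=> e; rewrite /Bgen evtD evtN !evtM !evtC !evtP hornerD hornerN !hornerM !hornerC.
    by rewrite e subrr.
  have [sG sGs hG] := gcd_linXY nn dd _ _ a b dd0 (d0sig j) co (cosig j) pr
    (proper_conj _ _ _ (sbij j) pr) b0 GB.
  split=> //; split=> [_ [i ->]|c hc]; first exact: GB.
  by apply: hG => i; apply: hc; exists i.
move=> ndef; apply: NNPP => no; apply: ndef.
apply: (defined_over_of_conj F K alpha n KP algF degA nn dd sigma) => // j g gK gI.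
have [j0|j0] := posnP j; first by rewrite (s0 j j0).
(* Since 1 divides everything, it can fail to be a gcd only through a common divisor that is not a
   unit. *)
have [c [hc nu]] : exists c, (forall B, Bset (sigma j) nn dd B -> rdvd c B) /\ ~ rdvd c 1.
  apply: NNPP => noc; apply: no; exists j; split=> //; split=> [B _|c hc].
    by exists B; rewrite mulr1.
  by apply: NNPP => nu; apply: noc; exists c.
apply: (conj_vanishes F K alpha n nn dd (sigma j) c) => // i.
by apply: hc; exists i.
Qed.
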